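(* Let $\phi$ be a $\mathbf G_q(\mathbf F_q,\mathbf G_q,\vee)$-formula that is finitely satisfiable. Then $\phi$ has a model with at most $|\phi|$ states.
   Context: Fix a finite set $\mathcal A$ of atomic propositions. A Markov chain is a tuple $M=(S,P,s_0,L)$ where $S$ is a countable set of states, $P:S\times S\to[0,1]$ satisfies $\sum_{t\in S}P(s,t)=1$ for all $s\in S$, $s_0\in S$ is the initial state, and $L:S\to 2^{\mathcal A}$ is a labeling. For $s\in S$, $\mathbb P_{M(s)}$ denotes the standard probability measure on runs (infinite sequences in $S^\omega$) starting in $s$, determined by giving the cylinder of a finite path $\rho_0\cdots\rho_n$ with $\rho_0=s$ probability $\prod_{0\le i<n}P(\rho_i,\rho_{i+1})$; $\pi[i]$ is the $i$-th state of run $\pi$. PCTL$(\mathbf F,\mathbf G)$ formulae are given by $\Phi::=a\mid\neg a\mid\Phi\wedge\Phi\mid\Phi\vee\Phi\mid\mathbf F_{\rhd q}\Phi\mid\mathbf G_{\rhd q}\Phi$ with $a\in\mathcal A$, $\rhd\in\{\ge,>\}$, $q\in[0,1]\cap\mathbb Q$. Semantics: $M,s\models a$ iff $a\in L(s)$; $M,s\models\neg a$ iff $a\notin L(s)$; $\wedge,\vee$ as usual; $M,s\models\mathbf F_{\rhd q}\varphi$ iff $\mathbb P_{M(s)}(\{\pi\mid\exists i\ge 0: M,\pi[i]\models\varphi\})\rhd q$; $M,s\models\mathbf G_{\rhd q}\varphi$ iff $\mathbb P_{M(s)}(\{\pi\mid\forall i\ge0: M,\pi[i]\models\varphi\})\rhd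 q$. $M$ is a model of $\phi$ if $M,s_0\models\phi$; $\phi$ is finitely satisfiable if it has a model with finite $S$. $|\phi|$ is the length of $\phi$. A $\mathbf G_q(\mathbf F_q,\mathbf G_q,\vee)$-formula is a formula of the form $\mathbf G_{\rhd q}\Psi$ where $\Psi::=a\mid\neg a\mid\Psi\wedge\Psi\mid\Psi\vee\Psi\mid\mathbf F_{\rhd q}\Psi\mid\mathbf G_{\rhd q}\Psi$ (any $\rhd\in\{\ge,>\}$, $q\in[0,1]\cap\mathbb Q$). *)

(* Defs.v *)
From HB Require Import structures.
From mathcomp Require Import all_boot all_order all_algebra.
From mathcomp Require Import all_classical all_reals all_analysis.
From mathcomp Require Import ring lra.

Set Implicit Arguments.
Unset Strict Implicit.
Unset Printing Implicit Defensive.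

Import Order.TTheory GRing.Theory Num.Theory.

Local Open Scope classical_set_scope.
Local Open Scope ring_scope.

Record markov_chain (R : realType) (AP : finType) := MarkovChain {
  state : countType;
  trans : state -> state -> R;
  trans_itv : forall s t, 0 <= trans s t <= 1;
  trans_sum1 : forall s, (\esum_(t in [set: state]) (trans s t)%:E = 1)%E;
  init : state;
  label : state -> {set AP} }.

Section runs.
Variables (R : realType) (AP : finType) (M : markov_chain R AP).

Definition run : Type := nat -> state M.

HB.instance Definition _ := gen_eqMixin run.
HB.instance Definition _ := gen_choiceMixin run.
(* measurableType requires a point; the choice made here plays no role *)
HB.instance Definition _ := isPointed.Build run (fun=> init M).

Definition cylinder (w : seq (state M)) : set run :=
  [set pi | mkseq pi (size w) = w].

Definition cylinders : set (set run) := range cylinder.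

Definition run_space := g_sigma_algebraType cylinders.

(* \prod_(0 <= i < n) P(rho_i, rho_(i+1)) for the path rho = s :: w *)
Fixpoint path_prob (s : state M) (w : seq (state M)) : R :=
  if w is t :: w' then trans s t * path_prob t w' else 1.

Definition is_run_measure (s : state M) (mu : probability run_space R) :=
  forall w, mu (cylinder (s :: w)) = (path_prob s w)%:E.

End runs.

(* Existence: push Lebesgue measure on [0, 1[ forward along the map sending x
   to the run whose successive states are read off from the nested intervals
   containing x, where the interval [a, a + l[ attached to a path ending in s
   is cut into consecutive pieces of length l * trans s t, t ranging over the
   states in pickle order. *)
Section run_measure_existence.
Variables (R : realType) (AP : finType) (M : markov_chain R AP).
Implicit Types (s t : state M) (a l x : R) (w : seq (state M)).

Local Definition p s n : R := if pickle_inv n is Some t then trans s t else 0.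

Local Definition cdf s n : R := \sum_(k < n) p s k.

Let trans_ge0 s t : 0 <= trans s t.
Proof. by have /andP[] := trans_itv s t. Qed.

Let p_ge0 s n : 0 <= p s n.
Proof. by rewrite /p; case: pickle_inv. Qed.

Let p_pickle s t : p s (pickle t) = trans s t.
Proof. by rewrite /p pickleK_inv. Qed.

Let cdfS s n : cdf s n.+1 = cdf s n + p s n.
Proof. by rewrite /cdf big_ord_recr. Qed.

Let cdf_pickle s t : cdf s (pickle t).+1 = cdf s (pickle t) + trans s t.
Proof. by rewrite cdfS p_pickle. Qed.

Let cdf_homo s m n : (m <= n)%N -> cdf s m <= cdf s n.
Proof.
move=> /subnK <-; elim: (n - m)%N => // k IH.
by rewrite addSn cdfS (le_trans IH)// lerDl.
Qed.

Let cdf_ge0 s n : 0 <= cdf s n.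
Proof. exact: sumr_ge0. Qed.

Let p_sum s : (\sum_(k <oo) (p s k)%:E = 1)%E.
Proof.
rewrite nneseries_esumT; last by move=> n; rewrite lee_fin.
rewrite -(trans_sum1 s).
rewrite (_ : \esum_(k in [set: nat]) (p s k)%:E =
             \esum_(k in range (@pickle (state M))) (p s k)%:E)%E; last first.
  rewrite [RHS]esum_mkcond; apply: eq_esum => k _; case: ifPn => // /negP kN.
  rewrite /p; case E : pickle_inv => [t|//]; exfalso; apply: kN.
  have := @pickle_invK (state M) k; rewrite E /= => <-.
  by rewrite inE; exists t.
rewrite (reindex_esum [set: state M] _ pickle).
  by apply: eq_esum => t _; rewrite p_pickle.
split; [by move=> t _; exists t| |by move=> _ [t _ <-]; exists t].
by move=> t t' _ _; apply: (pcan_inj (@pickleK_inv (state M))).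
Qed.

Let cdf_le1 s n : cdf s n <= 1.
Proof.
rewrite -lee_fin -(p_sum s) /cdf -sumEFin -(big_mkord xpredT (fun k => (p s k)%:E)).
by apply: nneseries_lim_ge => k _; rewrite lee_fin.
Qed.

Let cdf_gt s x : x < 1 -> exists n, x < cdf s n.
Proof.
move=> x1; apply: contrapT => /forallNP H.
suff : (\sum_(k <oo) (p s k)%:E <= x%:E)%E by rewrite p_sum lee_fin leNgt x1.
apply: lime_le; first by apply: is_cvg_nneseries => n _ _; rewrite lee_fin.
apply: nearW => n; rewrite big_mkord sumEFin lee_fin leNgt.
exact/negP/H.
Qed.

Local Definition cell x s a l t := a + l * cdf s (pickle t) <= x <
  a + l * cdf s (pickle t) + l * trans s t.

Let cell_ex x s a l : a <= x < a + l -> exists t, cell x s a l t.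
Proof.
move=> /andP[ax xal]; have l0 : 0 < l by lra.
have [|n0 xn0] := @cdf_gt s ((x - a) / l).
  by rewrite ltr_pdivrMr// mul1r; lra.
have exn : exists n, (x - a) / l < cdf s n by exists n0.
case: (ex_minnP exn) => -[|m].
  by rewrite /cdf big_ord0 ltr_pdivrMr// mul0r => ?; lra.
move=> lt_m min_m.
have le_m : cdf s m <= (x - a) / l.
  by rewrite leNgt; apply/negP => /min_m; rewrite ltnn.
move: lt_m; rewrite cdfS /p; case E : pickle_inv => [t|]; last first.
  by rewrite addr0 ltNge le_m.
have Em : pickle t = m.
  by have := @pickle_invK (state M) m; rewrite E.
move=> lt_m; exists t; rewrite /cell Em.
move: le_m lt_m; rewrite ler_pdivlMr// ltr_pdivrMr// mulrDl.
rewrite ![_ * l]mulrC => ? ?; lra.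
Qed.

Let cell_lt x s a l t t' : 0 <= l -> (pickle t < pickle t')%N ->
  cell x s a l t -> ~ cell x s a l t'.
Proof.
move=> l0 tt' /andP[_ h1] /andP[h2 _].
have := ler_wpM2l l0 (cdf_homo s tt'); rewrite cdf_pickle mulrDr => ?; lra.
Qed.

Let cell_uniq x s a l t t' : 0 <= l ->
  cell x s a l t -> cell x s a l t' -> t = t'.
Proof.
move=> l0 ct ct'; apply: (pcan_inj (@pickleK_inv (state M))).
case: (ltngtP (pickle t) (pickle t')) => // h.
  by have := cell_lt l0 h ct ct'.
by have := cell_lt l0 h ct' ct.
Qed.

Let cell_sub x s a l t : 0 <= l -> cell x s a l t -> a <= x < a + l.
Proof.
move=> l0 /andP[h1 h2].
have := mulr_ge0 l0 (cdf_ge0 s (pickle t)).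
have := ler_wpM2l l0 (cdf_le1 s (pickle t).+1); rewrite cdf_pickle mulrDr mulr1.
by move=> ? ?; apply/andP; split; lra.
Qed.

Local Definition next x (c : state M * R * R) : state M * R * R :=
  let: (s, a, l) := c in
  let t := xget s [set t | cell x s a l t] in
  (t, a + l * cdf s (pickle t), l * trans s t).

Local Definition orbit_run x (c : state M * R * R) (n : nat) : state M :=
  (iter n (next x) c).1.1.

Let nextE x s a l t : 0 <= l -> cell x s a l t ->
  next x (s, a, l) = (t, a + l * cdf s (pickle t), l * trans s t).
Proof.
move=> l0 ct; rewrite /next (_ : xget _ _ = t)//.
apply: xget_unique => // t' ct'.
exact: (cell_uniq l0 ct' ct).
Qed.

Let orbit_runS x c n : orbit_run x c n.+1 = orbit_run x (next x c) n.
Proof. by rewrite /orbit_run iterSr. Qed.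

Local Definition box (c : state M * R * R) w : R * R :=
  let: (_, a, l) := foldl (fun d t => let: (s, a, l) := d in
    (t, a + l * cdf s (pickle t), l * trans s t)) c w in (a, l).

Let box_cons s a l t w :
  box (s, a, l) (t :: w) = box (t, a + l * cdf s (pickle t), l * trans s t) w.
Proof. by []. Qed.

Let box_length s a l w : (box (s, a, l) w).2 = l * path_prob s w.
Proof.
elim: w s a l => [|t w IH] s a l /=; first by rewrite mulr1.
by rewrite box_cons IH mulrA.
Qed.

Local Definition inbox x (b : R * R) := b.1 <= x < b.1 + b.2.

Let box_sub x s a l w : 0 <= l -> inbox x (box (s, a, l) w) -> a <= x < a + l.
Proof.
elim: w s a l => [//|t w IH] s a l l0; rewrite box_cons => h.
apply: (@cell_sub x s a l t) => //; apply: IH h; exact: mulr_ge0.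
Qed.

Let orbit_runP x s a l w : 0 <= l -> a <= x < a + l ->
  mkseq (fun i => orbit_run x (s, a, l) i.+1) (size w) = w <->
  inbox x (box (s, a, l) w).
Proof.
elim: w s a l => [//|t w IH] s a l l0 xin; rewrite box_cons.
have [t' ct'] := cell_ex s xin.
have lt0 : 0 <= l * trans s t by exact: mulr_ge0.
have mkE : mkseq (fun i => orbit_run x (s, a, l) i.+1) (size (t :: w)) =
    t' :: mkseq (fun i => orbit_run x
      (t', a + l * cdf s (pickle t'), l * trans s t') i.+1) (size w).
  rewrite /mkseq /= -[1%N]addn0 iotaDl -map_comp; congr cons.
    by rewrite orbit_runS (nextE l0 ct').
  by apply: eq_map => i /=; rewrite add1n orbit_runS (nextE l0 ct').
rewrite mkE; split => [[tt']|h].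
  by subst t' => h; apply/IH.
have ct : cell x s a l t by apply: box_sub h.
have tt' := cell_uniq l0 ct' ct; subst t'; congr cons.
exact/IH.
Qed.

Variable s0 : state M.

Local Definition f (x : R) : run_space M := orbit_run x (s0, 0, 1).

Local Definition D : set R := [set` `[0, 1[].

Local Definition boxset w : set R :=
  [set` `[(box (s0, 0, 1) w).1, (box (s0, 0, 1) w).1 + (box (s0, 0, 1) w).2[].

Let preim_cyl t w : D `&` f @^-1` cylinder (t :: w) =
  if t == s0 then boxset w else set0.
Proof.
have mkE x : mkseq (f x) (size w).+1 =
    s0 :: mkseq (fun i => orbit_run x (s0, 0, 1) i.+1) (size w).
  rewrite /mkseq /= -[1%N]addn0 iotaDl -map_comp; congr cons.
apply/seteqP; split => x.
  rewrite /D /= in_itv/= /cylinder/= => -[x01]; rewrite mkE => -[<- h].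
  rewrite eqxx /boxset /= in_itv /=.
  have x01' : 0 <= x < 0 + 1 by rewrite add0r.
  exact: (proj1 (orbit_runP s0 w ler01 x01') h).
case: eqP => [->|//]; rewrite /boxset/= in_itv/= => h.
have x01 : 0 <= x < 0 + 1 by apply: (@box_sub x s0 0 1 w).
split; first by rewrite /D/= in_itv/=; rewrite add0r in x01.
by rewrite /cylinder /= mkE; congr cons; apply/orbit_runP.
Qed.

Let mD : measurable D. Proof. exact: measurable_itv. Qed.

Let mf : measurable_fun D f.
Proof.
apply: (@measurability _ _ _ (run_space M) D f (@cylinders R AP M)) => //.
move=> _ [_ [w _ <-] <-]; case: w => [|t w].
  rewrite (_ : cylinder [::] = setT) ?preimage_setT ?setIT//.
  exact/seteqP.
rewrite preim_cyl; case: ifP => // _; exact: measurable_itv.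
Qed.

Local Definition mu (A : set (run_space M)) : \bar R :=
  (@lebesgue_measure R) (D `&` f @^-1` A).

Let mu0 : mu set0 = 0%E.
Proof. by rewrite /mu preimage_set0 setI0 measure0. Qed.

Let mu_ge0 A : (0 <= mu A)%E.
Proof. exact: measure_ge0. Qed.

Let mu_sigma_additive : semi_sigma_additive mu.
Proof.
move=> F mF tF mUF; rewrite /mu preimage_bigcup setI_bigcupr.
apply: measure_semi_sigma_additive.
- by move=> n; exact: mf.
- apply/trivIsetP => /= i j _ _ ij; rewrite setIACA setIid -preimage_setI.
  by move/trivIsetP : tF => /(_ _ _ _ _ ij) ->//; rewrite preimage_set0 setI0.
- by rewrite -setI_bigcupr -preimage_bigcup; exact: mf.
Qed.

HB.instance Definition _ := isMeasure.Build _ _ _ mu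
  mu0 mu_ge0 mu_sigma_additive.

Let mu_setT : mu setT = 1%E.
Proof.
by rewrite /mu preimage_setT setIT lebesgue_measure_itv/= lte_fin ltr01 oppr0 adde0.
Qed.

HB.instance Definition _ := Measure_isProbability.Build _ _ _ mu mu_setT.

Lemma run_measure_exists : exists nu : probability (run_space M) R,
  is_run_measure s0 nu.
Proof.
exists mu => w; rewrite /= /mu preim_cyl eqxx /boxset lebesgue_measure_itv/=.
rewrite lte_fin box_length mul1r -EFinD addrAC subrr add0r ltrDl.
case: ltP => // h; apply/eqP; rewrite eqe eq_le h andbT.
elim: (w) (s0) => [|t v IH] s //=.
exact: mulr_ge0.
Qed.

End run_measure_existence.

(* the measure P_{M(s)} on runs *)
Definition run_measure (R : realType) (AP : finType) (M : markov_chain R AP)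
    (s : state M) : probability (run_space M) R :=
  sval (cid (run_measure_exists s)).

Lemma run_measureP (R : realType) (AP : finType) (M : markov_chain R AP)
  (s : state M) : is_run_measure s (run_measure s).
Proof. exact: (svalP (cid (run_measure_exists s))). Qed.

Section run_measure_unique.
Variables (R : realType) (AP : finType) (M : markov_chain R AP).

Lemma measurable_cylinder (w : seq (state M)) :
  measurable (cylinder w : set (run_space M)).
Proof. by apply: sub_sigma_algebra; exists w. Qed.

Lemma cylinder_nil : cylinder [::] = [set: run M].
Proof. exact/seteqP. Qed.

Lemma cylinderI (v w : seq (state M)) : (size v <= size w)%N ->
  cylinder v `&` cylinder w = set0 \/ cylinder v `&` cylinder w = cylinder w.
Proof.
move=> vw; have tk (pi : run M) :
    take (size v) (mkseq pi (size w)) = mkseq pi (size v).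
  by rewrite /mkseq -map_take take_iota (minn_idPl vw).
have [tw|tw] := eqVneq (take (size v) w) v; [right|left].
  apply/seteqP; split => [pi []//|pi]; rewrite /cylinder/= => piw; split => //.
  by rewrite -tk piw.
apply/seteqP; split => // pi [] /=; rewrite /cylinder/= => piv piw.
by move: (tk pi); rewrite piw piv; apply/eqP.
Qed.

Lemma run_measure_unique (s : state M) (nu : probability (run_space M) R) :
  is_run_measure s nu ->
  forall A : set (run_space M), measurable A -> nu A = run_measure s A.
Proof.
move=> nus; have mus := run_measureP s.
pose G : set (set (run_space M)) := @cylinders R AP M `|` [set set0].
have mG : G `<=` measurable.
  by move=> _ [[w _ <-]|->] //; exact: measurable_cylinder.
have cyl0 (m : probability (run_space M) R) t w : is_run_measure s m ->
    t != s -> m (cylinder (t :: w)) = 0%E.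
  move=> ms ts; apply/eqP; rewrite eq_le measure_ge0 andbT.
  rewrite (_ : 0%E = m (~` cylinder [:: s])); last first.
    by rewrite probability_setC ?ms ?subee//; exact: measurable_cylinder.
  apply: le_measure; rewrite ?inE; first exact: measurable_cylinder.
    by apply: measurableC; exact: measurable_cylinder.
  move=> pi; rewrite /cylinder /= => -[pi0 _] -[pi0'].
  by move/eqP: ts; rewrite -pi0 -pi0'.
move=> A mA; apply: (@g_sigma_algebra_measure_unique _ R _ G _ (fun=> setT)).
- exact: mG.
- by move=> _; left; exists [::]; rewrite ?cylinder_nil.
- by rewrite bigcup_const//; exists 0%N.
- move=> _ _ [[v _ <-]|->] [[w _ <-]|->]; rewrite ?set0I ?setI0; try by right.
  have [vw|/ltnW wv] := leqP (size v) (size w).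
    by have [->|->] := cylinderI vw; [right|left; exists w].
  by rewrite setIC; have [->|->] := cylinderI wv; [right|left; exists v].
- move=> _ [[[|t w] _ <-]|->]; last by rewrite !measure0.
    rewrite cylinder_nil.
    exact: etrans (probability_setT nu) (esym (probability_setT (run_measure s))).
  have [->|ts] := eqVneq t s; first exact: etrans (nus w) (esym (mus w)).
  exact: etrans (cyl0 nu t w nus ts) (esym (cyl0 (run_measure s) t w mus ts)).
- by move=> _; rewrite [ltLHS](_ : _ = 1%E) ?ltry//; exact: probability_setT.
- by apply: sub_smallest2r mA; [exact: smallest_sigma_algebra|move=> ? ?; left].
Qed.

Lemma measurable_run_coord (i : nat) (B : set (state M)) :
  measurable ([set pi | B (pi i)] : set (run_space M)).
Proof.
rewrite (_ : [set pi | _] = \bigcup_(w in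
    [set w | size w = i.+1 /\ B (last (init M) w)]) cylinder w).
  rewrite bigcup_mkcond; apply: countable_bigcupT_measurable => // w.
  by case: ifP => // _; exact: measurable_cylinder.
apply/seteqP; split => [pi /= Bpi|pi [w [sw Bw]]].
  exists (mkseq pi i.+1); last first.
    by change (mkseq pi (size (mkseq pi i.+1)) = mkseq pi i.+1); rewrite size_mkseq.
  split; first by rewrite size_mkseq.
  by rewrite /mkseq -addn1 iotaD map_cat last_cat.
rewrite /cylinder/= sw => piw; move: Bw.
by rewrite -piw /mkseq -addn1 iotaD map_cat last_cat.
Qed.

End run_measure_unique.

Inductive cmp : Type := GeCmp | GtCmp.

Definition compare_prob (R : realType) (c : cmp) (x y : \bar R) : bool :=
  match c with GeCmp => (y <= x)%E | GtCmp => (y < x)%E end.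

Definition threshold : Type := {q : rat | 0 <= q <= 1}.

Inductive formula (AP : finType) : Type :=
| Atom of AP
| NegAtom of AP
| And of formula AP & formula AP
| Or of formula AP & formula AP
| Finally of cmp & threshold & formula AP
| Globally of cmp & threshold & formula AP.

(* Number of symbols, a probabilistic operator with its subscript counting as
   one symbol. *)
Fixpoint formula_length (AP : finType) (phi : formula AP) : nat :=
  match phi with
  | Atom _ => 1
  | NegAtom _ => 2
  | And phi1 phi2 | Or phi1 phi2 =>
      (formula_length phi1 + formula_length phi2).+1
  | Finally _ _ phi1 | Globally _ _ phi1 => (formula_length phi1).+1
  end.

(* The grammar of the formulae allowed under the outermost G coincides with
   that of all formulae. *)
Definition is_G_formula (AP : finType) (phi : formula AP) : Prop :=
  exists (c : cmp) (q : threshold) (psi : formula AP),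
    phi = Globally c q psi.

Fixpoint sat (R : realType) (AP : finType) (M : markov_chain R AP)
    (phi : formula AP) (s : state M) : Prop :=
  match phi with
  | Atom a => a \in label s
  | NegAtom a => a \notin label s
  | And phi1 phi2 => sat phi1 s /\ sat phi2 s
  | Or phi1 phi2 => sat phi1 s \/ sat phi2 s
  | Finally c q phi1 =>
      compare_prob c (run_measure s [set pi | exists i : nat, sat phi1 (pi i)])
        (ratr (val q))%:E
  | Globally c q phi1 =>
      compare_prob c (run_measure s [set pi | forall i : nat, sat phi1 (pi i)])
        (ratr (val q))%:E
  end.

Definition is_model (R : realType) (AP : finType) (M : markov_chain R AP)
    (phi : formula AP) : Prop :=
  sat phi (init M).

Definition finitely_satisfiable (R : realType) (AP : finType)
    (phi : formula AP) : Prop :=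
  exists M : markov_chain R AP, finite_set [set: state M] /\ is_model M phi.

(* Main.v *)
(* If the outermost G has probability 0 in the given model, every chain is a
   model. Otherwise, by the maximum principle, the states maximizing the
   probability p(s) of always satisfying psi form a transition-closed set on
   which psi holds. In a minimal closed subset C of it, F_q chi holds nontrivially
   only if some state of C satisfies chi, and G_q chi only if all of them do.
   Keep one state of C as a witness for each F-subformula, plus one state so that
   the set is nonempty, and arrange them on a deterministic cycle: negation occurs
   only on atoms, so every subformula true at a kept state of C remains true. *)
Require Import Defs.
From HB Require Import structures.
From mathcomp Require Import all_boot all_order all_algebra.
From mathcomp Require Import all_classical all_reals all_analysis.

Set Implicit Arguments.
Unset Strict Implicit.
Unset Printing Implicit Defensive.

Import Order.TTheory GRing.Theory Num.Theory.

Local Open Scope classical_set_scope.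
Local Open Scope card_scope.

(** * Path events and the prefixing of a run by a state *)

Section runs.
Variables (R : realType) (AP : finType) (M : markov_chain R AP).
Implicit Types (s t : state M) (A C : set (state M)).
Local Open Scope ring_scope.

Lemma trans_ge0 s t : 0 <= trans s t.
Proof. by have /andP[] := trans_itv s t. Qed.

Definition always A : set (run_space M) := [set pi | forall i : nat, A (pi i)].

Definition eventually A : set (run_space M) := [set pi | exists i : nat, A (pi i)].

Lemma measurable_always A : measurable (always A).
Proof.
rewrite (_ : always A = \bigcap_i [set pi | A (pi i)]).
  by apply: bigcapT_measurable => i; exact: measurable_run_coord.
by apply/seteqP; split => [pi h i _|pi h i]; [exact: h|exact: (h i I)].
Qed.

Lemma measurable_eventually A : measurable (eventually A).
Proof.
rewrite (_ : eventually A = \bigcup_i [set pi | A (pi i)]).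
  by apply: bigcupT_measurable => i; exact: measurable_run_coord.
by apply/seteqP; split => pi [i]; exists i.
Qed.

Lemma run_measure_alwaysT s A : (forall t, A t) -> run_measure s (always A) = 1%E.
Proof.
move=> AT; rewrite (_ : always A = setT); last by apply/seteqP; split => // pi _ i.
exact: probability_setT.
Qed.

Lemma run_measure_start s : run_measure s (cylinder [:: s]) = 1%E.
Proof. exact: (run_measureP s [::]). Qed.

Lemma run_measure_start0 s A : ~ A s -> run_measure s [set pi | A (pi 0%N)] = 0%E.
Proof.
move=> As; apply/eqP; rewrite eq_le measure_ge0 andbT.
have mc := measurable_cylinder [:: s].
rewrite (_ : 0%E = run_measure s (~` cylinder [:: s])); last first.
  by rewrite probability_setC// run_measure_start subee.
apply: le_measure; rewrite ?inE; first exact: measurable_run_coord.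
  exact: measurableC.
by move=> pi /= Api; rewrite /cylinder /= => -[pis]; apply: As; rewrite -pis.
Qed.

Lemma run_measure_always0 s A : ~ A s -> run_measure s (always A) = 0%E.
Proof.
move=> As; apply/eqP; rewrite eq_le measure_ge0 andbT -(run_measure_start0 As).
apply: le_measure; rewrite ?inE; first exact: measurable_always.
  exact: measurable_run_coord.
by move=> pi; apply.
Qed.

(** Right inverse of the shift: the law of runs from [s] is the mixture, weighted by [trans s t], of
    the images under this map of the laws from [t]. *)
Definition cons_run s (pi : run_space M) : run_space M :=
  fun n => if n is m.+1 then pi m else s.

Lemma preimage_cons_run_cylinder s t w :
  cons_run s @^-1` cylinder (t :: w) = if t == s then cylinder w else set0.
Proof.
have mkE pi : mkseq (cons_run s pi) (size w).+1 = s :: mkseq pi (size w).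
  by rewrite /mkseq /= -[1%N]addn0 iotaDl -map_comp.
apply/seteqP; split => pi.
  by rewrite /cylinder /= mkE => -[<- h]; rewrite eqxx.
by case: eqP => [->|//]; rewrite /cylinder /= mkE => ->.
Qed.

Lemma measurable_cons_run s : measurable_fun setT (cons_run s).
Proof.
apply: (@measurability _ _ _ (run_space M) _ _ (@cylinders R AP M)) => //.
move=> _ [_ [w _ <-] <-]; rewrite setTI; case: w => [|t w].
  by rewrite cylinder_nil preimage_setT.
by rewrite preimage_cons_run_cylinder; case: ifP => // _; exact: measurable_cylinder.
Qed.

End runs.

(** * First-step analysis in a finite chain *)

Section finite_chain.
Variables (R : realType) (AP : finType) (M : markov_chain R AP).
Hypothesis finM : finite_set [set: state M].
Implicit Types (s t : state M) (A C D : set (state M)).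
Local Open Scope ring_scope.

Local Notation states := (finmap.enum_fset (fset_set [set: state M])).

Lemma mem_states s : s \in states.
Proof. by have := in_fset_set finM s; rewrite in_setT. Qed.

Lemma sum_trans s : \sum_(t <- states) trans s t = 1.
Proof.
apply: EFin_inj; rewrite -sumEFin -fsbig_finite// -esum_fset//.
  exact: trans_sum1.
by move=> t _; rewrite lee_fin trans_ge0.
Qed.

(** Building the mixture as a sum of scaled pushforwards makes it a measure by construction, so that
    uniqueness of [run_measure] can be applied to it. *)
Lemma first_step_measure s (r : seq (state M)) :
  exists nu : {measure set (run_space M) -> \bar R}, forall E,
    nu E = (\sum_(t <- r) (trans s t)%:E * run_measure t (cons_run s @^-1` E))%E.
Proof.
elim: r => [|t r [nu nuE]]; first by exists mzero => E; rewrite big_nil.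
have mc := measurable_cons_run s.
pose c : {mfun run_space M >-> run_space M} := HB.pack (cons_run s)
  (isMeasurableFun.Build _ _ _ _ (cons_run s) mc).
exists (measure_add (mscale (NngNum (trans_ge0 s t))
  (distribution (run_measure t) c)) nu) => E.
by rewrite big_cons -nuE; exact: measure_addE.
Qed.

(** Both sides are probability measures in [E], and they agree on the cylinders starting at [s]. *)
Lemma run_measure_first_step s (E : set (run_space M)) : measurable E ->
  run_measure s E =
  (\sum_(t <- states) (trans s t)%:E * run_measure t (cons_run s @^-1` E))%E.
Proof.
move=> mE; have [nu nuE] := first_step_measure s states.
have sum1 : (\sum_(t <- states) (trans s t)%:E * run_measure t setT = 1)%E.
  rewrite -[RHS]/(1%R%:E) -(sum_trans s) -sumEFin; apply: eq_bigr => t _.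
  by transitivity ((trans s t)%:E * 1)%E;
    [congr (_ * _)%E; exact: probability_setT | rewrite mule1].
have nu1 : nu setT = 1%E.
  by rewrite nuE; under eq_bigr do rewrite preimage_setT.
(* Normalizing only supplies the [probability] structure: the mass is already 1, so [P] and [nu]
   coincide. *)
pose P := mnormalize nu (run_measure s).
have PE F : P F = nu F.
  by rewrite /P /mnormalize nu1 onee_eq0 /= invr1 mule1.
rewrite -nuE -PE; apply/esym; apply: (@run_measure_unique R AP M s P) => // w.
rewrite [LHS]PE.
rewrite nuE; under eq_bigr do rewrite preimage_cons_run_cylinder eqxx.
case: w => [|u w] /=.
  by rewrite cylinder_nil.
(* Runs from a state other than [u] almost surely do not begin with [u], so only the summand of [u]
   survives. *)
rewrite (bigD1_seq u) ?mem_states//=; last exact: finmap.fset_uniq.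
rewrite run_measureP -EFinM big1 ?adde0// => t tu.
rewrite (_ : run_measure t _ = 0%E) ?mule0//.
apply/eqP; rewrite eq_le measure_ge0 andbT.
rewrite -(@run_measure_start0 _ _ _ t [set u]); last by apply/eqP.
apply: le_measure; rewrite ?inE; first exact: measurable_cylinder.
  exact: measurable_run_coord.
by move=> pi; rewrite /cylinder/= => -[].
Qed.

(** * Closed sets and the maximum principle *)

Definition closed_states C := forall s t, C s -> trans s t != 0 -> C t.

Definition always_prob A s : R := fine (run_measure s (always A)).

Lemma always_probE A s : (always_prob A s)%:E = run_measure s (always A).
Proof. by rewrite fineK// fin_num_measure//; exact: measurable_always. Qed.

(** A run that stays in [A] still does so once its first state is dropped. Equality may fail when
    [s] is outside [A]. *)
Lemma always_prob_le_mean A s :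
  always_prob A s <= \sum_(t <- states) trans s t * always_prob A t.
Proof.
rewrite -lee_fin -sumEFin always_probE run_measure_first_step; last first.
  exact: measurable_always.
apply: lee_sum => t _; rewrite EFinM always_probE lee_wpmul2l ?lee_fin ?trans_ge0//.
apply: le_measure; rewrite ?inE.
- rewrite -[X in measurable X]setTI; apply: measurable_cons_run => //.
  exact: measurable_always.
- exact: measurable_always.
- by move=> pi h i; exact: (h i.+1).
Qed.

Lemma finite_argmax (g : state M -> R) C : C !=set0 ->
  exists2 s, C s & forall t, C t -> g t <= g s.
Proof.
move=> [x Cx]; have : exists2 s, C s & forall t, t \in states -> C t -> g t <= g s.
  elim: (states) => [|y r [s Cs sP]]; first by exists x.
  have [[Cy sy]|nsy] := pselect (C y /\ g s <= g y).
    exists y => // t; rewrite inE => /orP[/eqP->//|tr Ct].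
    exact: le_trans (sP _ tr Ct) sy.
  exists s => // t; rewrite inE => /orP[/eqP-> Cy|/sP//].
  by rewrite leNgt; apply/negP => /ltW ?; apply: nsy.
by move=> [s Cs sP]; exists s => // t Ct; exact: sP (mem_states t) Ct.
Qed.

(* Maximum principle: a maximum of [always_prob A] propagates along transitions. *)
Lemma closed_argmax A C s : closed_states C -> C s ->
  (forall t, C t -> always_prob A t <= always_prob A s) ->
  closed_states [set t | C t /\ always_prob A t = always_prob A s].
Proof.
move=> clC Cs smax t u [Ct tE] tu; split; first exact: clC Ct tu.
set m := always_prob A s in smax tE *.
have ge0 v : 0 <= trans t v * (m - always_prob A v).
  have [->|tv] := eqVneq (trans t v) 0; first by rewrite mul0r.
  by rewrite mulr_ge0 ?trans_ge0// subr_ge0 smax//; exact: clC Ct tv.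
(* The weights sum to 1 and [t] attains [m], so the mean inequality bounds this sum of nonnegative
   terms by 0; hence each term vanishes, that of [u] included. *)
have : \sum_(v <- states) trans t v * (m - always_prob A v) == 0.
  rewrite eq_le sumr_ge0// andbT.
  under eq_bigr do rewrite mulrBr.
  rewrite sumrB -mulr_suml sum_trans mul1r subr_le0 -tE.
  exact: always_prob_le_mean.
rewrite psumr_eq0// => /allP /(_ u (mem_states u)) /=.
by rewrite mulf_eq0 (negbTE tu) /= subr_eq0 => /eqP.
Qed.

(** [D] consists of the maximizers over [C]. The maximum is positive, whereas the probability is 0
    outside [A]. *)
Lemma always_prob_gt0_closed A C s : closed_states C -> C s ->
  0 < always_prob A s ->
  exists D, [/\ closed_states D, D !=set0, D `<=` C & D `<=` A].
Proof.
move=> clC Cs s0; have [|u Cu umax] := @finite_argmax (always_prob A) C.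
  by exists s.
exists [set t | C t /\ always_prob A t = always_prob A u]; split.
- exact: closed_argmax.
- by exists u.
- by move=> t [].
- move=> t [Ct tE]; apply: contrapT => At.
  have := lt_le_trans s0 (umax _ Cs); rewrite -tE.
  by rewrite /always_prob run_measure_always0//= ltxx.
Qed.

(** These are the bottom strongly connected components of the transition graph. *)
Definition minimal_closed C := [/\ closed_states C, C !=set0 &
  forall D, closed_states D -> D !=set0 -> D `<=` C -> C `<=` D].

(** Descent on the number of states in [C]. *)
Lemma minimal_closed_exists C : closed_states C -> C !=set0 ->
  exists2 D, minimal_closed D & D `<=` C.
Proof.
have [n] := ubnP (count (fun t => `[< C t >]) states).
elim: n C => // n IH C Cn clC C0.
have [mC|nmC] := pselect (minimal_closed C); first by exists C.
have [D [clD D0 DC nCD]] : exists D,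
    [/\ closed_states D, D !=set0, D `<=` C & ~ C `<=` D].
  apply: contrapT => h; apply: nmC; split => // D clD D0 DC.
  by apply: contrapT => nCD; apply: h; exists D.
have [x Cx Dx] : exists2 x, C x & ~ D x.
  apply: contrapT => h; apply: nCD => x Cx; apply: contrapT => Dx.
  by apply: h; exists x.
have [|E mE ED] := IH D _ clD D0; last by exists E => //; apply: subset_trans DC.
move: Cn; rewrite ltnS; apply: leq_trans.
have -> : count (fun t => `[< C t >]) states = (count (fun t => `[< D t >]) states +
    count (fun t => `[< C t >] && ~~ `[< D t >]) states)%N.
  rewrite -count_predUI [X in (_ + X)%N](_ : _ = 0%N) ?addn0.
    apply: eq_count => t /=; have [Dt|Dt] := asboolP (D t) => /=.
      by apply/asboolP/DC.
    by rewrite andbT.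
  apply/eqP; rewrite -leqn0 leqNgt -has_count; apply/hasP => -[t _ /=].
  by case: `[< D t >]; rewrite ?andbF.
rewrite -[X in (X < _)%N]addn0 ltn_add2l -has_count; apply/hasP; exists x.
  exact: mem_states.
by rewrite asboolT//= asboolF.
Qed.

Lemma minimal_closed_always A C s : minimal_closed C -> C s ->
  (0 < run_measure s (always A))%E -> C `<=` A.
Proof.
move=> [clC C0 minC] Cs; rewrite -always_probE lte_fin => s0.
have [D [clD D0 DC DA]] := always_prob_gt0_closed clC Cs s0.
exact: subset_trans (minC _ clD D0 DC) DA.
Qed.

(** If [C] misses [A], first-step analysis makes a visit to [A] at any fixed time null, and a
    countable union of null events is null. *)
Lemma closed_eventually A C s : closed_states C -> C s ->
  (0 < run_measure s (eventually A))%E -> exists2 t, C t & A t.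
Proof.
move=> clC Cs; apply: contraPP => CA; apply/negP; rewrite -leNgt.
have nA t : C t -> ~ A t by move=> Ct At; apply: CA; exists t.
have step i t : C t -> run_measure t [set pi | A (pi i)] = 0%E.
  elim: i t => [|i IH] t Ct; first exact: run_measure_start0 (nA _ Ct).
  rewrite run_measure_first_step; last exact: measurable_run_coord.
  rewrite big1// => u _.
  have [->|tu] := eqVneq (trans t u) 0; first by rewrite mul0e.
  by rewrite [X in (_ * X)%E](IH u (clC _ _ Ct tu)) mule0.
have -> : eventually A = \bigcup_i [set pi | A (pi i)].
  by apply/seteqP; split => pi [i]; exists i.
rewrite (_ : run_measure s _ = 0%E)//; apply/negligibleP.
  by apply: bigcupT_measurable => i; exact: measurable_run_coord.
apply: negligible_bigcup => i; apply/negligibleP; last exact: step.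
exact: measurable_run_coord.
Qed.

End finite_chain.

(** * The deterministic cycle *)

Section cycle.
Variables (R : realType) (AP : finType) (n : nat) (lab : 'I_n.+1 -> {set AP}).
Local Open Scope ring_scope.

Definition cycle_trans (i j : 'I_n.+1) : R := (j == ordS i)%:R.

Lemma cycle_trans_itv i j : 0 <= cycle_trans i j <= 1.
Proof. by rewrite /cycle_trans; case: eqP => _; rewrite ?lexx ler01. Qed.

Lemma cycle_trans_sum1 i :
  (\esum_(j in [set: 'I_n.+1]) (cycle_trans i j)%:E = 1)%E.
Proof.
transitivity (\esum_(j in [set ordS i]) (1 : \bar R))%E; last by rewrite esum_set1.
rewrite [RHS]esum_mkcond; apply: eq_esum => j _; rewrite /cycle_trans.
by case: eqP => [->|/eqP ji]; [rewrite mem_set|rewrite memNset//; exact/eqP].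
Qed.

Definition cycle_chain : markov_chain R AP :=
  MarkovChain cycle_trans_itv cycle_trans_sum1 ord0 lab.

Lemma iter_ordS (i : 'I_n.+1) k : iter k (@ordS n.+1) i = ((i + k) %% n.+1)%N :> nat.
Proof.
elim: k => [|k IH] /=; first by rewrite addn0 modn_small.
by rewrite IH -addn1 modnDml -addnA addn1.
Qed.

Lemma cycle_hits (i j : 'I_n.+1) : exists k, iter k (@ordS n.+1) i = j.
Proof.
(* The first [n.+1 - i] steps lead from [i] round to 0, the next [j] to [j]. *)
exists (n.+1 - i + j)%N; apply/val_inj; rewrite /= iter_ordS addnA subnKC.
  by rewrite modnDl modn_small.
exact/ltnW.
Qed.

Lemma cycle_path_prob (i : state cycle_chain) k :
  path_prob i (traject (@ordS n.+1) (ordS i) k) = 1.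
Proof. by elim: k i => //= k IH i; rewrite IH /cycle_trans eqxx mulr1. Qed.

(** The cylinder of the unique path from [i] to a state of [A] already has mass 1. *)
Lemma cycle_eventually (A : set (state cycle_chain)) i :
  A !=set0 -> run_measure i (eventually A) = 1%E.
Proof.
move=> [j Aj]; have [k kE] := cycle_hits i j.
have mE := measurable_eventually A.
apply/eqP; rewrite eq_le probability_le1//=.
have := run_measureP i (traject (@ordS n.+1) (ordS i) k).
rewrite cycle_path_prob => <-; apply: le_measure; rewrite ?inE//.
  exact: measurable_cylinder.
move=> pi; rewrite /cylinder /= size_traject => piE; exists k.
have := congr1 (fun w => nth i w k) piE.
rewrite nth_mkseq// => ->.
rewrite [X in A X](_ : _ = j)//; rewrite -kE.
exact: (@nth_traject _ (@ordS n.+1) k k.+1).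
Qed.

End cycle.

(** * Witness states and transfer of formulae to the cycle *)

Lemma compare_prob_le (R : realType) c (x y q : \bar R) :
  (x <= y)%E -> compare_prob c x q -> compare_prob c y q.
Proof.
by case: c => /= xy qx; [exact: le_trans qx xy|exact: lt_le_trans qx xy].
Qed.

Fixpoint witnesses (R : realType) (AP : finType) (M : markov_chain R AP)
    (C : set (state M)) (phi : formula AP) : seq (state M) :=
  match phi with
  | Atom _ | NegAtom _ => [::]
  | And phi1 phi2 | Or phi1 phi2 => witnesses C phi1 ++ witnesses C phi2
  | Finally _ _ phi1 =>
      if pselect (exists t, C t /\ sat phi1 t) is left ex
      then sval (cid ex) :: witnesses C phi1 else witnesses C phi1
  | Globally _ _ phi1 => witnesses C phi1
  end.

Section witnesses.
Variables (R : realType) (AP : finType) (M : markov_chain R AP).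
Variable C : set (state M).

Lemma size_witnesses phi : size (witnesses C phi) <= formula_length phi.
Proof.
elim: phi => //= [phi1 IH1 phi2 IH2|phi1 IH1 phi2 IH2|c q phi IH|c q phi IH].
- by rewrite size_cat ltnW// ltnS leq_add.
- by rewrite size_cat ltnW// ltnS leq_add.
- by case: pselect => ex //=; exact: ltnW.
- exact: ltnW.
Qed.

Lemma witnesses_sub phi t : t \in witnesses C phi -> C t.
Proof.
elim: phi => //= [phi1 IH1 phi2 IH2|phi1 IH1 phi2 IH2|c q phi IH].
- by rewrite mem_cat => /orP[].
- by rewrite mem_cat => /orP[].
- case: pselect => ex //=; rewrite inE => /orP[/eqP->|//].
  by case: cid => u [].
Qed.

Hypothesis finM : finite_set [set: state M].
Hypothesis minC : minimal_closed C.
Variables (n : nat) (L : 'I_n.+1 -> state M).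
Hypothesis LC : forall i, C (L i).

(** Every threshold passed in [M] is passed on the cycle for one of two reasons: the probability in
    [M] is 0, or that on the cycle is 1. *)
Lemma sat_cycle phi :
  (forall t, t \in witnesses C phi -> exists i, L i = t) ->
  forall i, sat phi (L i) ->
    sat phi (i : state (cycle_chain R (fun i => label (L i)))).
Proof.
elim: phi => //= [phi1 IH1 phi2 IH2|phi1 IH1 phi2 IH2|c q phi IH|c q phi IH] wL i.
- move=> [h1 h2]; split; [apply: IH1 h1 => t tw|apply: IH2 h2 => t tw];
    by apply: wL; rewrite mem_cat tw ?orbT.
- by move=> [h|h]; [left; apply: IH1 h => t tw|right; apply: IH2 h => t tw];
    apply: wL; rewrite mem_cat tw ?orbT.
- move=> h; set x := run_measure _ _ in h.
  have [x0|x0] := leP x 0%E.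
    by apply: compare_prob_le h; apply: (le_trans x0); exact: measure_ge0.
  case: minC => clC _ _.
  have [t Ct st] := @closed_eventually _ _ _ finM [set t | sat phi t] _ _ clC (LC i) x0.
  have ex : exists t, C t /\ sat phi t by exists t.
  (* The proof [ex] is replaced by the one inside [witnesses], so that [cid] picks the same state in
     both places. *)
  move: wL; case: pselect => // {}ex wL.
  have [j Lj] := wL _ (mem_head _ _).
  apply: compare_prob_le h; rewrite [leRHS]cycle_eventually.
    exact: probability_le1 (measurable_eventually [set t | sat phi t]).
  exists j; apply: IH => [u uw|]; first by apply: wL; rewrite inE uw orbT.
  by rewrite Lj; case: cid => u [].
- move=> h; set x := run_measure _ _ in h.
  have [x0|x0] := leP x 0%E.
    by apply: compare_prob_le h; apply: (le_trans x0); exact: measure_ge0.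
  have CA := @minimal_closed_always _ _ _ finM [set t | sat phi t] _ _ minC (LC i) x0.
  apply: compare_prob_le h; rewrite [leRHS](_ : _ = 1%E).
    exact: probability_le1 (measurable_always [set t | sat phi t]).
  by apply: run_measure_alwaysT => j; apply: IH => //; exact/CA/LC.
Qed.

End witnesses.

Theorem theorem1 (R : realType) (AP : finType) (phi : formula AP) :
  is_G_formula phi -> finitely_satisfiable R phi ->
  exists M : markov_chain R AP,
    is_model M phi /\ [set: state M] #<= `I_(formula_length phi).
Proof.
move=> [c [q [psi ->]]] [M [finM]]; rewrite /is_model /= => h.
set x := run_measure _ _ in h.
have [x0|x0] := leP x 0%E.
  (* The threshold is met by probability 0, so a one-state loop with any label will do. *)
  exists (cycle_chain R (fun _ : 'I_1 => label (init M))); split; last first.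
    by rewrite -(card_le_eql card_II) card_le_II.
  by apply: compare_prob_le h; apply: (le_trans x0); exact: measure_ge0.
have [D [clD D0 _ DA]] : exists D, [/\ closed_states D, D !=set0,
    D `<=` [set: state M] & D `<=` [set t | sat psi t]].
  apply: (@always_prob_gt0_closed _ _ _ finM _ _ (init M)) => //.
  by rewrite -lte_fin always_probE.
have [C minC CD] := minimal_closed_exists finM clD D0.
have [_ [s Cs] _] := minC.
pose w := s :: witnesses C psi.
(* The cycle runs over positions in [w], so a state listed several times does no harm. *)
pose L (i : 'I_(size (witnesses C psi)).+1) := nth s w i.
have LC i : C (L i).
  have : L i \in w by rewrite mem_nth//= ltn_ord.
  by rewrite inE => /orP[/eqP->//|/witnesses_sub].
exists (cycle_chain R (fun i => label (L i))); split; last first.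
  (* The extra state [s] is paid for by the outermost [Globally]. *)
  by rewrite -(card_le_eql card_II) card_le_II ltnS size_witnesses.
apply: compare_prob_le h; rewrite [leRHS](_ : _ = 1%E).
  exact: probability_le1 (measurable_always [set t | sat psi t]).
apply: run_measure_alwaysT => i; apply: (sat_cycle finM minC LC) => [t tw|].
  have tw' : t \in w by rewrite inE tw orbT.
  have it : (index t w < size w)%N by rewrite index_mem.
  by exists (Ordinal it); rewrite /L nth_index.
exact/DA/CD/LC.
Qed.
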